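(* Let $n\ge 1$. For every element $X \in \mathfrak{sp}(2n,\mathbb{C})$ there exists $g \in \mathrm{Sp}(2n,\mathbb{C})$ with $g^2=-\mathrm{I}_{2n}$ (a skew-involution) such that $-X = gXg^{-1}$. Hence every element of $\mathrm{Lie}(\mathrm{PSp}(2n,\mathbb{C}))$ is strongly $\mathrm{Ad}_{\mathrm{PSp}(2n,\mathbb{C})}$-real.
   Context: Let $\mathrm{I}_n$ be the $n\times n$ identity matrix and $\mathrm{J}_{2n} = \begin{pmatrix} 0 & \mathrm{I}_n\\ -\mathrm{I}_n & 0\end{pmatrix}$. Set $\mathrm{Sp}(2n,\mathbb{C}) = \{ g \in \mathrm{GL}(2n,\mathbb{C}) \mid g^T \mathrm{J}_{2n} g = \mathrm{J}_{2n}\}$ and $\mathfrak{sp}(2n,\mathbb{C}) = \{X \in \mathrm{M}(2n,\mathbb{C}) \mid X^T \mathrm{J}_{2n} = -\mathrm{J}_{2n}X\}$, its Lie algebra. $\mathrm{PSp}(2n,\mathbb{C}) = \mathrm{Sp}(2n,\mathbb{C})/\{\pm \mathrm{I}_{2n}\}$; its Lie algebra is denoted $\mathrm{Lie}(\mathrm{PSp}(2n,\mathbb{C}))$ and is identified with $\mathfrak{sp}(2n,\mathbb{C})$ via the quotient map, the class of $g$ acting by $\mathrm{Ad}([g])X=gXg^{-1}$. For a Lie group $G$ with Lie algebra $\mathfrak g$, an element $X\in\mathfrak g$ is called strongly $\mathrm{Ad}_G$-real if $\mathrm{Ad}(h)X=-X$ for some involution $h\in G$, where an involution is an element of order at most two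 (so $h^2$ is the identity of $G$). *)

(* Defs.v *)
From HB Require Import structures.
From mathcomp Require Import all_boot all_order all_algebra.
From mathcomp Require Import generic_quotient.
From mathcomp Require Import complex.
From mathcomp Require Import reals.

Set Implicit Arguments.
Unset Strict Implicit.
Unset Printing Implicit Defensive.

Import GRing.Theory.

Local Open Scope ring_scope.
Local Open Scope quotient_scope.

Section Symplectic.
Context (F : fieldType) (n : nat).
Implicit Types (A : 'M[F]_(n + n)).

Definition Jmx : 'M[F]_(n + n) := block_mx 0 1%:M (- 1%:M) 0.

Definition symplectic_group : {pred 'M[F]_(n + n)} :=
  fun g => (g \in unitmx) && (g^T *m Jmx *m g == Jmx).

Definition symplectic_lie : {pred 'M[F]_(n + n)} :=
  fun X => X^T *m Jmx == - (Jmx *m X).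

Record Sp := MkSp { Sp_val :> 'M[F]_(n + n); Sp_valP : Sp_val \in symplectic_group }.
HB.instance Definition _ := [isSub for Sp_val].
HB.instance Definition _ := [Choice of Sp by <:].

Record sp := Mksp { sp_val :> 'M[F]_(n + n); sp_valP : sp_val \in symplectic_lie }.
HB.instance Definition _ := [isSub for sp_val].
HB.instance Definition _ := [Choice of sp by <:].

Lemma symplectic_lie_submod : submod_closed symplectic_lie.
Proof.
split=> [|a X Y]; rewrite !unfold_in; first by rewrite trmx0 mul0mx mulmx0 oppr0.
move=> /eqP hX /eqP hY.
by rewrite linearP /= mulmxDl -scalemxAl hX hY mulmxDr -scalemxAr opprD scalerN.
Qed.
HB.instance Definition _ :=
  GRing.isSubmodClosed.Build F 'M[F]_(n + n) symplectic_lie symplectic_lie_submod.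
HB.instance Definition _ := [SubChoice_isSubLmodule of sp by <:].

Lemma Sp_unit (g : Sp) : (g : 'M_(n + n)) \in unitmx.
Proof. by have /andP[] := Sp_valP g. Qed.

Lemma Sp_eq (g : Sp) : g^T *m Jmx *m g = Jmx.
Proof. by have /andP[_ /eqP] := Sp_valP g. Qed.

Lemma Sp_trJ (g : Sp) : g^T *m Jmx = Jmx *m invmx g.
Proof. by rewrite -[in RHS](Sp_eq g) mulmxK // Sp_unit. Qed.

Lemma Sp_VtrJ (g : Sp) : (invmx g)^T *m Jmx = Jmx *m g.
Proof. by rewrite trmx_inv -[in LHS](Sp_eq g) !mulmxA mulVmx ?unitmx_tr ?Sp_unit // mul1mx. Qed.

Lemma Sp_one_subproof : 1%:M \in symplectic_group.
Proof. by rewrite unfold_in unitmx1 trmx1 mul1mx mulmx1 eqxx. Qed.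

Lemma Sp_mul_subproof (g h : Sp) : (g : 'M_(n + n)) *m h \in symplectic_group.
Proof.
rewrite unfold_in unitmx_mul !Sp_unit /= trmx_mul.
have -> : h^T *m g^T *m Jmx *m ((g : 'M_(n + n)) *m h)
         = h^T *m (g^T *m Jmx *m g) *m h by rewrite !mulmxA.
by rewrite !Sp_eq.
Qed.

Lemma Sp_inv_subproof (g : Sp) : invmx g \in symplectic_group.
Proof. by rewrite unfold_in unitmx_inv Sp_unit Sp_VtrJ mulmxK ?Sp_unit /=. Qed.

Definition Sp_one := MkSp Sp_one_subproof.
Definition Sp_mul g h := MkSp (Sp_mul_subproof g h).
Definition Sp_inv g := MkSp (Sp_inv_subproof g).

Fact Sp_mulA : associative Sp_mul.
Proof. by move=> g h k; apply: val_inj; rewrite /= mulmxA. Qed.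
Fact Sp_mul1 : left_id Sp_one Sp_mul.
Proof. by move=> g; apply: val_inj; rewrite /= mul1mx. Qed.
Fact Sp_1mul : right_id Sp_one Sp_mul.
Proof. by move=> g; apply: val_inj; rewrite /= mulmx1. Qed.
Fact Sp_mulV : left_inverse Sp_one Sp_inv Sp_mul.
Proof. by move=> g; apply: val_inj; rewrite /= mulVmx ?Sp_unit. Qed.
Fact Sp_Vmul : right_inverse Sp_one Sp_inv Sp_mul.
Proof. by move=> g; apply: val_inj; rewrite /= mulmxV ?Sp_unit. Qed.

HB.instance Definition _ :=
  isGroup.Build Sp Sp_mulA Sp_mul1 Sp_1mul Sp_mulV Sp_Vmul.

Definition skew_involution (g : Sp) : Prop :=
  (g : 'M_(n + n)) *m g = - 1%:M.

Lemma Sp_conj_subproof (g : Sp) (X : sp) :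
  (g : 'M_(n + n)) *m X *m invmx g \in symplectic_lie.
Proof.
have /eqP hX := sp_valP X.
rewrite unfold_in !trmx_mul -!mulmxA Sp_trJ !mulmxA -[_ *m X^T *m Jmx]mulmxA hX.
by rewrite mulmxN mulmxA Sp_VtrJ mulNmx -!mulmxA.
Qed.

Definition Ad_Sp (g : Sp) (X : sp) : sp := Mksp (Sp_conj_subproof g X).

Definition pm1 : {pred Sp} :=
  fun z => (val z == 1%:M) || (val z == - 1%:M).

Definition PSp_rel (g h : Sp) : bool := (g^-1 * h)%g \in pm1.

Lemma PSp_relE (g h : Sp) :
  PSp_rel g h = (val h == val g) || (val h == - val g).
Proof.
have E (c : 'M[F]_(n + n)) : (invmx g *m h == c) = (val h == val g *m c).
  apply/eqP/eqP => [<-|/= ->]; first by rewrite /= mulKVmx ?Sp_unit.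
  by rewrite mulKmx ?Sp_unit.
by rewrite /PSp_rel unfold_in /= !E mulmx1 mulmxN mulmx1.
Qed.

Lemma PSp_rel_equiv : equiv_class_of PSp_rel.
Proof.
split=> [g|g h|h g k]; rewrite !PSp_relE ?eqxx //.
  by rewrite eq_sym; congr (_ || _); rewrite -eqr_oppLR eq_sym.
by case/orP=> /eqP ->; rewrite ?opprK // orbC.
Qed.

Canonical PSp_equiv := EquivRelPack PSp_rel_equiv.

Definition PSp := {eq_quot PSp_rel}.
HB.instance Definition _ := Choice.on PSp.
HB.instance Definition _ := EqQuotient.on PSp.

Definition PSp_one : PSp := \pi 1%g.
Definition PSp_mul : PSp -> PSp -> PSp := lift_op2 PSp (fun g h : Sp => (g * h)%g).
Definition PSp_inv : PSp -> PSp := lift_op1 PSp (fun g : Sp => g^-1%g).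

Lemma pi_PSpP (g h : Sp) :
  reflect (\pi_PSp g = \pi_PSp h) ((val h == val g) || (val h == - val g)).
Proof. by rewrite -PSp_relE; apply: (iffP idP) => /eqmodP. Qed.

Lemma repr_PSp (g : Sp) :
  val (repr (\pi_PSp g)) = val g \/ val (repr (\pi_PSp g)) = - val g.
Proof.
have /esym/pi_PSpP/orP[] := reprK (\pi_PSp g) => /eqP; by [left | right].
Qed.

Lemma invmxN A : invmx (- A) = - invmx A.
Proof.
have [uA|nuA] := boolP (A \in unitmx); last first.
  by rewrite /invmx -scaleN1r unitmxZ ?unitrN1 // (negPf nuA) scaleN1r.
by rewrite -scaleN1r invmxZ ?unitmxZ ?unitrN1 // invrN1 scaleN1r.
Qed.

Lemma pi_PSp_mul (g h : Sp) : \pi_PSp (g * h)%g = PSp_mul (\pi g) (\pi h).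
Proof.
unlock PSp_mul; apply/pi_PSpP => /=.
by case: (repr_PSp g) => /= ->; case: (repr_PSp h) => /= ->;
  rewrite ?mulNmx ?mulmxN ?opprK eqxx ?orbT.
Qed.

Lemma pi_PSp_inv (g : Sp) : \pi_PSp g^-1%g = PSp_inv (\pi g).
Proof.
unlock PSp_inv; apply/pi_PSpP => /=.
by case: (repr_PSp g) => /= ->; rewrite ?invmxN eqxx ?orbT.
Qed.

Fact PSp_mulA : associative PSp_mul.
Proof.
by elim/quotW=> g; elim/quotW=> h; elim/quotW=> k; rewrite -!pi_PSp_mul mulgA.
Qed.
Fact PSp_mul1 : left_id PSp_one PSp_mul.
Proof. by elim/quotW=> g; rewrite -pi_PSp_mul mul1g. Qed.
Fact PSp_1mul : right_id PSp_one PSp_mul.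
Proof. by elim/quotW=> g; rewrite -pi_PSp_mul mulg1. Qed.
Fact PSp_mulV : left_inverse PSp_one PSp_inv PSp_mul.
Proof. by elim/quotW=> g; rewrite -pi_PSp_inv -pi_PSp_mul mulVg. Qed.
Fact PSp_Vmul : right_inverse PSp_one PSp_inv PSp_mul.
Proof. by elim/quotW=> g; rewrite -pi_PSp_inv -pi_PSp_mul mulgV. Qed.

HB.instance Definition _ :=
  isGroup.Build PSp PSp_mulA PSp_mul1 PSp_1mul PSp_mulV PSp_Vmul.

(* The differential of the quotient map identifies Lie(PSp) with sp. *)
Definition LiePSp := sp.
HB.instance Definition _ := GRing.Lmodule.on LiePSp.

(* The choice of representative is immaterial by Ad_PSp_pi. *)
Definition Ad_PSp (c : PSp) (X : LiePSp) : LiePSp := Ad_Sp (repr c) X.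

Lemma Ad_PSp_pi (g : Sp) (X : LiePSp) : Ad_PSp (\pi g) X = Ad_Sp g X.
Proof.
apply: val_inj => /=.
by case: (repr_PSp g) => /= ->; rewrite ?invmxN ?mulNmx ?mulmxN ?opprK.
Qed.

Lemma Ad_PSp_linear (c : PSp) : linear (Ad_PSp c).
Proof.
move=> a X Y; apply: val_inj => /=.
by rewrite linearP /= mulmxDl -scalemxAl.
Qed.

Lemma Ad_PSp1 (X : LiePSp) : Ad_PSp 1%g X = X.
Proof.
by rewrite Ad_PSp_pi; apply: val_inj; rewrite /= mul1mx invmx1 mulmx1.
Qed.

Lemma Ad_PSpM (c d : PSp) (X : LiePSp) :
  Ad_PSp (c * d)%g X = Ad_PSp c (Ad_PSp d X).
Proof.
elim/quotW: c => g; elim/quotW: d => h.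
rewrite -[(_ * _)%g]pi_PSp_mul !Ad_PSp_pi; apply: val_inj => /=.
have /= -> := congr1 val (invgM g h).
by rewrite !mulmxA.
Qed.

End Symplectic.

Definition involution (G : groupType) (h : G) : Prop := (h ^+ 2 = 1)%g.

(* Ad is the adjoint action of G on its Lie algebra. *)
Definition strongly_Ad_real (G : groupType) (L : zmodType) (Ad : G -> L -> L)
    (X : L) : Prop :=
  exists2 h : G, involution h & Ad h X = - X.

(* Main.v *)
Require Import Defs.
From HB Require Import structures.
From mathcomp Require Import all_boot all_order all_algebra.
From mathcomp Require Import perm ring.
From mathcomp Require Import complex.
From mathcomp Require Import reals.

(** Let J be the matrix of the symplectic form. Every complex square matrix X
    admits an invertible symmetric S with X^T S = S X (by induction: split off a
    maximal Jordan chain of an eigenvalue, on which a Hankel matrix does the job,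
    together with an invariant complement). For X in the Lie algebra, g0 = J S
    anticommutes with X and is itself infinitesimally symplectic, so C = - g0^2
    commutes with X and is self-adjoint for the symplectic form. Over the complex
    numbers C has a square root P that is a polynomial in C, hence is also
    self-adjoint and commutes with X and g0; then g = g0 P^-1 works. *)

Set Implicit Arguments.
Unset Strict Implicit.
Unset Printing Implicit Defensive.
Import GRing.Theory.
Local Open Scope ring_scope.

(** * Symmetric matrices intertwining a matrix and its transpose *)

(* With H = W Phi, the space splits as W + U with U = ker Phi; S is the form H on W
   plus SU on U, and P = Q U is the projection onto U along W. *)
Lemma sym_intertwiner_step (F : fieldType) (n d r : nat) (N : 'M[F]_n)
    (W : 'M[F]_(d, n)) (Phi : 'M[F]_(n, d)) (C D : 'M[F]_d)
    (U : 'M[F]_(r, n)) (SU : 'M[F]_r) :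
  row_free U -> (U :=: kermx Phi)%MS ->
  W *m N = D *m W -> N *m Phi = Phi *m C ->
  W *m Phi \in unitmx -> (W *m Phi)^T = W *m Phi ->
  (W *m N *m Phi)^T = W *m N *m Phi ->
  SU^T = SU -> SU \in unitmx ->
  U *m N *m pinvmx U *m SU = SU *m (U *m N *m pinvmx U)^T ->
  exists S : 'M[F]_n, [/\ S^T = S, S \in unitmx & N *m S = S *m N^T].
Proof.
move=> freeU eqU WN NPhi uH symH symHN symSU uSU intSU.
set H := W *m Phi in uH symH; set AU := U *m N *m pinvmx U in intSU.
have UPhi : U *m Phi = 0 by apply/sub_kermxP; rewrite eqU.
have kerU m (x : 'M_(m, n)) : x *m Phi = 0 -> (x <= U)%MS.
  by move=> x0; rewrite eqU; apply/sub_kermxP.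
have AU_U : AU *m U = U *m N.
  by rewrite mulmxKpV // kerU // -mulmxA NPhi mulmxA UPhi mul0mx.
clearbody AU.
pose P := 1%:M - Phi *m invmx H *m W.
have [Q QU] : exists Q, Q *m U = P.
  (* The rows of [P] lie in [U] because [P Phi = Phi - Phi H^-1 (W Phi) = 0]. *)
  by exists (P *m pinvmx U); rewrite mulmxKpV // kerU //
     mulmxBl mul1mx -(mulmxA _ W) -/H mulmxKV // subrr.
have cancelU m (x y : 'M_(m, _)) : x *m U = y *m U -> x = y.
  exact: row_free_inj.
have UQ : U *m Q = 1%:M.
  by apply: cancelU; rewrite -mulmxA QU mulmxBr !mulmxA UPhi !mul0mx subr0 mulmx1 mul1mx.
have WQ : W *m Q = 0.
  by apply: cancelU; rewrite -mulmxA QU mulmxBr !mulmxA -/H mulmxV //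
     mul1mx mulmx1 subrr mul0mx.
have HCDH : H *m C = D *m H by rewrite -mulmxA -NPhi mulmxA WN -mulmxA.
have CH : C *m invmx H = invmx H *m D.
  by apply: (can_inj (mulKmx uH)); rewrite mulKVmx // mulmxA HCDH mulmxK.
have NP : N *m P = P *m N.
  rewrite mulmxBr mulmxBl mulmx1 mul1mx; congr (_ - _).
  by rewrite !mulmxA NPhi -[Phi *m C *m _]mulmxA CH -!mulmxA WN.
have NQ : N *m Q = Q *m AU.
  by apply: cancelU; rewrite -!mulmxA AU_U QU NP mulmxA QU.
have symCH : (C *m invmx H)^T = C *m invmx H.
  have symHC : (H *m C)^T = H *m C by rewrite -mulmxA -NPhi mulmxA.
  rewrite trmx_mul trmx_inv symH; apply: (can_inj (mulKmx uH)).
  by rewrite mulKVmx // mulmxA -[H *m C]symHC trmx_mul symH mulmxK.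
(* As a bilinear form, the first summand has Gram matrix [H] on [W] and vanishes on [U], since
   [U Phi = 0]; the second has Gram matrix [SU] on [U] and vanishes on [W], since [W Q = 0]. *)
exists (Phi *m invmx H *m Phi^T + Q *m SU *m Q^T); split.
- by rewrite linearD /= !trmx_mul !trmxK trmx_inv symH symSU !mulmxA.
- rewrite -row_free_unit; apply: inj_row_free => x; rewrite mulmxDr !mulmxA => xS0.
  have xPhi : x *m Phi = 0.
    have := congr1 (mulmx^~ W^T) xS0; rewrite mul0mx mulmxDl -!mulmxA -!trmx_mul WQ.
    by rewrite -/H symH trmx0 !mulmx0 addr0 mulVmx // mulmx1.
  have xQ : x *m Q = 0.
    have := congr1 (mulmx^~ U^T) xS0; rewrite xPhi !mul0mx add0r -!mulmxA -!trmx_mul UQ.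
    by rewrite trmx1 mulmx1 mulmxA => /(congr1 (mulmx^~ (invmx SU)));
      rewrite mulmxK // mul0mx.
  have /submxP[c xc] := kerU _ _ xPhi.
  by rewrite xc -[c]mulmx1 -UQ mulmxA -xc xQ mul0mx.
- rewrite mulmxDr mulmxDl; congr (_ + _); last first.
    by rewrite -!mulmxA -trmx_mul NQ trmx_mul !mulmxA NQ
       -[Q *m AU *m SU]mulmxA intSU !mulmxA.
  rewrite !mulmxA NPhi -!mulmxA -trmx_mul NPhi trmx_mul !mulmxA -(mulmxA Phi) -symCH.
  by rewrite trmx_mul trmx_inv symH !mulmxA.
Qed.

(** Otherwise the kernel dimensions would increase strictly at each of the first [n.+1] steps and
    exceed [n]. *)
Lemma kermx_exp_stable (F : fieldType) (n : nat) (N : 'M[F]_n) :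
  exists d, (kermx (N ^+ d.+1) <= kermx (N ^+ d))%MS.
Proof.
suff /exists_inP[d _ Hd] : [exists d in 'I_n.+1, (kermx (N ^+ d.+1) <= kermx (N ^+ d))%MS].
  by exists d.
apply: contraT => /exists_inPn no.
have : forall d, (d <= n.+1)%N -> (d <= \rank (kermx (N ^+ d)))%N.
  elim=> // d IHd ltd; apply: leq_ltn_trans (IHd (ltnW ltd)) _.
  apply: rank_ltmx; rewrite ltmxE (no (Ordinal ltd)) // andbT.
  by apply/sub_kermxP; rewrite exprSr -mulmxE mulmxA mulmx_ker mul0mx.
by move/(_ n.+1 (leqnn _)); rewrite leqNgt ltnS rank_leq_row.
Qed.

(* Take for d.+1 the exponent where the kernels of the powers of N stabilise: the
   end of a chain of that length then lies outside the row space of N ^+ d.+1. *)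
Lemma singular_jordan_chain (F : fieldType) (n : nat) (N : 'M[F]_n) :
  N \notin unitmx ->
  exists (d : nat) (v : 'rV[F]_n) (phi : 'cV[F]_n),
    [/\ v *m N ^+ d.+1 = 0, N ^+ d.+1 *m phi = 0 & (v *m N ^+ d *m phi) 0 0 != 0].
Proof.
move=> sN; case: (ex_minnP (kermx_exp_stable N)) => d stab mind.
case: d => [|d] in stab mind *.
  case/negP: sN; rewrite -row_free_unit -kermx_eq0 -submx0.
  by apply: submx_trans stab _; apply/rV_subP => v /sub_kermxP;
    rewrite mulmx1 => ->; exact: sub0mx.
have /row_subPn[k] : ~~ (kermx (N ^+ d.+1) <= kermx (N ^+ d))%MS.
  by apply/negP => /mind; rewrite ltnn.
set v := row k _ => /sub_kermxP/eqP vNd.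
have vN : v *m N ^+ d.+1 = 0 by rewrite -row_mul mulmx_ker row0.
(* If [v N^d = w N^(d+1)], then [w N^(d+2) = v N^(d+1) = 0]; stability of the kernels gives
   [w N^(d+1) = 0], hence [v N^d = 0], against the choice of [v]. *)
have : ~~ (v *m N ^+ d <= N ^+ d.+1)%MS.
  apply/negP => /submxP[w vw]; case/negP: vNd; rewrite vw; apply/eqP/sub_kermxP.
  apply: submx_trans stab; apply/sub_kermxP.
  by rewrite exprSr -mulmxE mulmxA -vw -mulmxA mulmxE -exprSr.
rewrite submxE => /rV0Pn[j vj].
exists d, v, (col j (cokermx (N ^+ d.+1))); split=> //.
- by rewrite colE mulmxA mulmx_coker mul0mx.
- by rewrite colE mulmxA -colE mxE.
Qed.

(** Reversing the order of the rows makes the matrix lower triangular with [h d] all along the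
    diagonal. *)
Lemma hankel_unit (F : fieldType) (d : nat) (h : nat -> F) :
  h d != 0 -> (forall k, (d < k)%N -> h k = 0) ->
  \matrix_(i < d.+1, j < d.+1) h (i + j)%N \in unitmx.
Proof.
move=> hd h0; set H := \matrix_(i, j) _.
suff : row_perm (perm (@rev_ord_inj d.+1)) H \in unitmx.
  by rewrite row_permE unitmx_mul unitmx_perm.
rewrite unitmxE unitfE det_trig; last first.
  apply/is_trig_mxP => i j ltij; rewrite !mxE permE /= h0 // subSS.
  by rewrite -[X in (X < _)%N](@subnK i) ?ltn_add2l // -ltnS.
by apply/prodf_neq0 => i _; rewrite !mxE permE /= subSS subnK // -ltnS.
Qed.

Lemma sym_intertwiner (F : closedFieldType) (n : nat) (A : 'M[F]_n) :
  exists S : 'M[F]_n, [/\ S^T = S, S \in unitmx & A *m S = S *m A^T].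
Proof.
have [m] := ubnP n; elim: m => // m IHm in n A *; rewrite ltnS => lenm.
case: (posnP n) => [n0|n_gt0].
  by subst n; exists 1%:M; rewrite trmx1 unitmx1 mulmx1 mul1mx (flatmx0 A) trmx0.
have [a] : exists a, root (char_poly A) a.
  by apply/closed_rootP; rewrite size_char_poly eqSS -lt0n.
rewrite -eigenvalue_root_char /eigenvalue /eigenspace kermx_eq0 row_free_unit.
set N := A - a%:M => sN.
(* The scalar part [a] contributes [a S] to both sides, so [N] may replace [A]. *)
have {}IH (S : 'M_n) : S^T = S -> S \in unitmx -> N *m S = S *m N^T ->
    exists S : 'M[F]_n, [/\ S^T = S, S \in unitmx & A *m S = S *m A^T].
  move=> symS uS; rewrite linearB /= tr_scalar_mx mulmxBl mulmxBr scalar_mxC.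
  by move/addIr => intS; exists S.
have [d [v [phi [vN Nphi vNphi]]]] := singular_jordan_chain sN.
(* The chains generated by [v] and [phi] pair to [v N^(i+j) phi], which depends only on [i + j]:
   this makes both [W Phi] and [W N Phi] symmetric. *)
pose W := \matrix_(i < d.+1) (v *m N ^+ i).
pose Phi := \matrix_(i < n, j < d.+1) (N ^+ j *m phi) i 0.
have colPhi j : col j Phi = N ^+ j *m phi by apply/colP=> i; rewrite !mxE.
pose h k := (v *m N ^+ k *m phi) 0 0.
have WN : (W *m N <= W)%MS.
  apply/row_subP => i; rewrite row_mul rowK -mulmxA mulmxE -exprSr.
  have:= ltn_ord i; rewrite ltnS leq_eqVlt => /predU1P[->|lti].
    by rewrite vN sub0mx.
  by rewrite (eq_row_sub (Ordinal (lti : (i.+1 < d.+1)%N))) // rowK.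
have NPhi : ((N *m Phi)^T <= Phi^T)%MS.
  apply/row_subP => i; rewrite -tr_col colE -mulmxA -colE colPhi mulmxA mulmxE -exprS.
  have:= ltn_ord i; rewrite ltnS leq_eqVlt => /predU1P[->|lti].
    by rewrite Nphi trmx0 sub0mx.
  by rewrite (eq_row_sub (Ordinal (lti : (i.+1 < d.+1)%N))) // -tr_col colPhi.
have WPhi : W *m Phi = \matrix_(i, j) h (i + j)%N.
  apply/matrixP => i j; rewrite mxE -[RHS]/(h _).
  have -> : (W *m Phi) i j = (row i W *m col j Phi) 0 0.
    by rewrite !mxE; apply: eq_bigr => k _; rewrite !mxE.
  by rewrite rowK colPhi mulmxA -(mulmxA v) mulmxE -exprD.
have WNPhi : W *m N *m Phi = \matrix_(i, j) h (i + j).+1%N.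
  apply/matrixP => i j; rewrite mxE -[RHS]/(h _).
  have -> : (W *m N *m Phi) i j = (row i W *m N *m col j Phi) 0 0.
    by rewrite -row_mul !mxE; apply: eq_bigr => k _; rewrite !mxE.
  by rewrite rowK colPhi mulmxA -2!(mulmxA v) mulmxE -exprSr -exprD addSn.
have /submxP[D WND] := WN.
have /submxP[Ct NPhiC] := NPhi.
(* The complement is proper: the last column [N^d phi] of [Phi] pairs with [v] to a nonzero
   scalar. *)
have ltU : (\rank (kermx Phi) < m)%N.
  apply: leq_trans lenm; rewrite mxrank_ker -subn_gt0 subKn ?rank_leq_row // lt0n.
  rewrite mxrank_eq0; apply: contra_neq vNphi => Phi0.
  by rewrite -mulmxA -[N ^+ d]/(N ^+ @ord_max d) -colPhi Phi0 col0 mulmx0 mxE.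
have [SU [symSU uSU intSU]] :=
  IHm _ (row_base (kermx Phi) *m N *m pinvmx (row_base (kermx Phi))) ltU.
have [S [symS uS intS]] :
    exists S : 'M[F]_n, [/\ S^T = S, S \in unitmx & N *m S = S *m N^T].
  apply: (@sym_intertwiner_step _ _ _ _ N W Phi Ct^T D (row_base (kermx Phi)) SU) => //.
  - exact: row_base_free.
  - exact: eq_row_base.
  - by apply: trmx_inj; rewrite NPhiC trmx_mul trmxK.
  - rewrite WPhi; apply: hankel_unit => // k ltk.
    by rewrite /h -(subnKC ltk) exprD -mulmxE mulmxA vN !mul0mx mxE.
  - by rewrite WPhi; apply/matrixP => i j; rewrite !mxE addnC.
  - by rewrite WNPhi; apply/matrixP => i j; rewrite !mxE addnC.
exact: IH symS uS intS.
Qed.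

(** * Polynomial square roots of invertible matrices *)

(** Linear factors are adjoined one at a time, so repeated elements of [s] (eigenvalues with
    multiplicity) need no separate lifting argument. *)
Lemma sqrtX_mod (F : closedFieldType) (s : seq F) :
  (2 : F) != 0 -> 0 \notin s ->
  exists p : {poly F}, \prod_(a <- s) ('X - a%:P) %| p ^+ 2 - 'X.
Proof.
move=> nz2; elim: s => [|a s IHs]; first by exists 0; rewrite big_nil dvd1p.
rewrite inE negb_or eq_sym => /andP[nza /IHs[p]]; rewrite big_cons.
set f := \prod_(b <- s) _ => /dvdpP[k pk].
(* Lift p to p + c f; the condition at a is quadratic in c, and it is only
   degenerate when f(a) = 0 = p(a), which would force a = p(a)^2 = 0. *)
pose q := k.[a]%:P + (2 * p.[a]) *: 'X + f.[a] *: 'X^2 : {poly F}.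
have [c /rootP qc] : exists c, root q c.
  apply/closed_rootP/negP => /size_poly1P[e _ qe].
  have fa0 : f.[a] = 0.
    by have := congr1 (coefp 2%N) qe; rewrite /= !coefE !mulr0 !mulr1 !add0r.
  have pa0 : p.[a] = 0.
    have := congr1 (coefp 1%N) qe; rewrite /= !coefE mulr1 mulr0 addr0 add0r.
    by move/eqP; rewrite mulf_eq0 (negPf nz2) => /eqP.
  have := congr1 (horner^~ a) pk.
  by rewrite !hornerE fa0 pa0 expr0n mulr0 sub0r => /eqP; rewrite oppr_eq0 (negPf nza).
exists (p + c%:P * f).
have -> : (p + c%:P * f) ^+ 2 - 'X = (k + 2 * c%:P * p + c%:P ^+ 2 * f) * f.
  transitivity (p ^+ 2 - 'X + (2 * c%:P * p + c%:P ^+ 2 * f) * f); first by ring.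
  by rewrite pk -mulrDl addrA.
rewrite dvdp_mul // dvdp_XsubCl; apply/rootP; rewrite -[RHS]qc !hornerE.
rewrite /=; ring.
Qed.

(** With [D = C] this gives commutation, and with [D = C^T] self-adjointness, of polynomials in
    [C]. *)
Lemma horner_mx_intertwine (R : comNzRingType) (n : nat) (C D M : 'M[R]_n.+1)
    (p : {poly R}) :
  C *m M = M *m D -> horner_mx C p *m M = M *m horner_mx D p.
Proof.
move=> CM; elim/poly_ind: p => [|p c IHp]; first by rewrite !rmorph0 mul0mx mulmx0.
rewrite !rmorphD !rmorphM /= !horner_mx_X !horner_mx_C -!mulmxE mulmxDl mulmxDr.
by rewrite -mulmxA CM !mulmxA IHp scalar_mxC.
Qed.

Lemma trmx_horner_mx (R : comNzRingType) (n : nat) (C : 'M[R]_n.+1) (p : {poly R}) :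
  (horner_mx C p)^T = horner_mx C^T p.
Proof.
elim/poly_ind: p => [|p c IHp]; first by rewrite !rmorph0 trmx0.
rewrite !rmorphD !rmorphM /= !horner_mx_X !horner_mx_C -!mulmxE linearD /=.
rewrite trmx_mul IHp tr_scalar_mx; congr (_ + _).
exact/esym/comm_horner_mx.
Qed.

(** If [p^2] is congruent to ['X] modulo the characteristic polynomial of [C], Cayley-Hamilton makes
    [p(C)] a square root. *)
Lemma sqrt_mx (F : closedFieldType) (n : nat) (C : 'M[F]_n) :
  (2 : F) != 0 -> C \in unitmx ->
  exists P : 'M[F]_n,
    [/\ P *m P = C, forall M : 'M[F]_n, C *m M = M *m C -> P *m M = M *m P
      & forall M : 'M[F]_n, C *m M = M *m C^T -> P *m M = M *m P^T].
Proof.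
move=> nz2; case: n C => [|n] C uC.
  by exists C; split=> [|M _|M _]; rewrite [LHS]flatmx0 [RHS]flatmx0.
have [s char_s] := closed_field_poly_normal (char_poly C).
move: char_s; rewrite (monicP (char_poly_monic C)) scale1r => char_s.
(* Zero is not an eigenvalue: the constant coefficient of the characteristic polynomial is the
   determinant up to sign. *)
have /(sqrtX_mod nz2)[p /dvdpP[k pk]] : 0 \notin s.
  rewrite -root_prod_XsubC -char_s /root horner_coef0 char_poly_det mulf_eq0 negb_or.
  by rewrite signr_eq0 -unitfE -unitmxE.
exists (horner_mx C p); split=> [|M|M CM].
- have := congr1 (horner_mx C) pk.
  rewrite -char_s rmorphM /= Cayley_Hamilton mulr0 rmorphB rmorphXn /= horner_mx_X.
  by move/eqP; rewrite subr_eq0 expr2 -mulmxE => /eqP.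
- exact: horner_mx_intertwine.
- by rewrite trmx_horner_mx; exact: horner_mx_intertwine.
Qed.

(** * The symplectic form and the skew-involution *)

Section Jmx.
Context (F : fieldType) (n : nat).
Local Notation J := (Jmx F n).

Lemma trmx_Jmx : J^T = - J.
Proof.
by rewrite /Jmx tr_block_mx opp_block_mx !trmx0 linearN /= trmx1 !oppr0 opprK.
Qed.

Lemma mulJJ : J *m J = - 1%:M.
Proof.
rewrite /Jmx mulmx_block !mul0mx !mulmx0 !mul1mx !mulmx1 !add0r !addr0.
by rewrite scalar_mx_block opp_block_mx !oppr0.
Qed.

End Jmx.

Lemma sp_skew_involution (F : closedFieldType) (n : nat) (X : sp F n) :
  (2 : F) != 0 ->
  exists g : Sp F n, skew_involution g /\ - (X : 'M_(n + n)) = g *m X *m invmx g.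
Proof.
move=> nz2; have /eqP XJ := sp_valP X; move: (sp_val X) XJ => {X} X XJ.
pose J := Jmx F n; rewrite -/J in XJ.
have JJ : J *m J = - 1%:M by exact: mulJJ.
have JT : J^T = - J by exact: trmx_Jmx.
have [S [ST uS]] := sym_intertwiner X^T; rewrite trmxK => XS.
have uJ : J \in unitmx.
  by case: (mulmx1_unit (_ : J *m (- J) = 1%:M)); rewrite // mulmxN JJ opprK.
have JE : Jmx F n = J by []; clearbody J.
have XTJ : J *m X^T = - (X *m J).
  apply: (can_inj (mulmxK uJ)).
  by rewrite -mulmxA XJ mulmxN mulmxA JJ mulNmx mul1mx opprK
     mulNmx -mulmxA JJ mulmxN mulmx1 opprK.
pose g0 := J *m S.
have g0X : g0 *m X = - (X *m g0) by rewrite -mulmxA -XS mulmxA XTJ mulNmx -mulmxA.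
have ug0 : g0 \in unitmx by rewrite unitmx_mul uJ.
have g0T : g0^T = - (S *m J) by rewrite trmx_mul ST JT mulmxN.
have g0g0 : J *m (- (g0 *m g0)) = S *m J *m S.
  by rewrite mulmxN !mulmxA JJ !mulNmx mul1mx opprK.
have g0Jg0 : g0^T *m J *m g0 = S *m J *m S.
  by rewrite g0T /g0 !mulmxA !mulNmx -[S *m J *m J]mulmxA JJ mulmxN mulmx1 !mulNmx opprK.
have g0g0J : g0 *m g0 *m J = J *m (g0^T *m g0^T).
  by rewrite g0T mulNmx !mulmxN opprK /g0 !mulmxA.
clearbody g0; pose C := - (g0 *m g0).
have uC : C \in unitmx by rewrite /C -scaleN1r unitmxZ ?unitrN1 // unitmx_mul ug0.
have [P [PP commP adjP]] := sqrt_mx nz2 uC.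
have uP : P \in unitmx by move: uC; rewrite -PP unitmx_mul => /andP[].
have PJ : P *m J = J *m P^T.
  by apply: adjP; rewrite /C linearN /= trmx_mul mulNmx mulmxN g0g0J.
have JP : J *m P = P^T *m J.
  apply: (can_inj (mulmxK uJ)); rewrite -mulmxA PJ mulmxA JJ mulNmx mul1mx.
  by rewrite -mulmxA JJ mulmxN mulmx1.
have Pg0 : P *m g0 = g0 *m P by apply: commP; rewrite /C mulNmx mulmxN mulmxA.
have PX : P *m X = X *m P.
  by apply: commP; rewrite /C mulNmx -mulmxA g0X !mulmxN mulmxA g0X mulNmx opprK -mulmxA.
have invP M : P *m M = M *m P -> invmx P *m M = M *m invmx P.
  by move=> PM; apply: (can_inj (mulKmx uP)); rewrite mulKVmx // mulmxA PM mulmxK.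
have JV : (invmx P)^T *m J = J *m invmx P.
  rewrite trmx_inv; apply: (can_inj (mulmxK uP)).
  by rewrite mulmxKV // -mulmxA JP mulKmx // unitmx_tr.
pose g := g0 *m invmx P.
have ug : g \in unitmx by rewrite unitmx_mul ug0 unitmx_inv.
have g_symp : g \in @symplectic_group F n.
  rewrite unfold_in ug /= -/(Jmx F n) JE /g trmx_mul; apply/eqP.
  (* The middle factor equals [J C = J P P], and self-adjointness moves [P^-1] across [J], where
     both copies of [P] cancel. *)
  transitivity ((invmx P)^T *m (g0^T *m J *m g0) *m invmx P); first by rewrite !mulmxA.
  by rewrite g0Jg0 -g0g0 -/C -PP !mulmxA JV mulmxKV // -mulmxA mulmxV // mulmx1.
exists (MkSp g_symp); split; rewrite /skew_involution /=.
  rewrite /g -mulmxA [invmx P *m _]mulmxA invP // !mulmxA -[g0 *m g0]opprK -/C.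
  by rewrite -PP !mulNmx mulmxK // mulmxV.
by rewrite -[g *m X]mulmxA invP // mulmxA g0X mulNmx -mulmxA mulNmx mulmxK.
Qed.

(** * Strong reality in the projective symplectic group *)

Local Open Scope complex_scope.

Theorem theorem1p2 (R : realType) (n : nat) (hn : (1 <= n)%N) :
  (forall X : sp R[i] n, exists g : Sp R[i] n,
      skew_involution g /\
      - (X : 'M[R[i]]_(n + n)) = (g : 'M[R[i]]_(n + n)) *m X *m invmx g) /\
  (forall X : LiePSp R[i] n, strongly_Ad_real (@Ad_PSp R[i] n) X).
Proof.
have nz2 : (2 : R[i]) != 0 by rewrite Num.Theory.pnatr_eq0.
split=> X; first exact: sp_skew_involution.
have [g [gg gX]] := sp_skew_involution X nz2.
exists (\pi_(PSp R[i] n) g)%qT.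
  (* The class of [g] squares to the class of [-1], which is the identity of the quotient. *)
  rewrite /involution expgS expg1 -[LHS]pi_PSp_mul; apply/pi_PSpP => /=.
  by rewrite gg opprK eqxx orbT.
by rewrite Ad_PSp_pi; apply: val_inj; rewrite /= -gX.
Qed.
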